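(* Let $\mathcal C=\mathcal C(I,A,(\rho_i)_{i\in I},(C^a)_{a\in A})$ be a Cartan scheme such that $\mathcal R^{\mathrm{re}}(\mathcal C)$ is a finite root system of type $\mathcal C$, let $a\in A$, and let $(\cdot,\cdot)$ be a scalar product on $\mathbb R^I$. Let $\mathcal A^a_{\mathcal C}$ be the set of hyperplanes $H_\alpha=\{\lambda\in\mathbb R^I\mid(\lambda,\alpha)=0\}$ for $\alpha\in(R^{\mathrm{re}})^a_+$. Then $\mathcal A^a_{\mathcal C}$ is a simplicial arrangement, i.e. all connected components of $\mathbb R^I\setminus\bigcup_{H\in\mathcal A^a_{\mathcal C}}H$ are open simplicial cones.
   Context: Cartan schemes. Let $I,A$ be finite sets, $A\neq\emptyset$, and $(\alpha_i)_{i\in I}$ the standard basis of $\mathbb Z^I$. A Cartan scheme $\mathcal C=\mathcal C(I,A,(\rho_i)_{i\in I},(C^a)_{a\in A})$ consists of maps $\rho_i:A\to A$ ($i\in I$) and (integer) generalized Cartan matrices $C^a=(c^a_{jk})_{j,k\in I}$ ($a\in A$) such that $\rho_i^2=\mathrm{id}$ and $c^a_{ij}=c^{\rho_i(a)}_{ij}$ for all $a\in A$, $i,j\in I$. Define $\sigma_i^a\in\operatorname{Aut}(\mathbb Z^I)$ by $\sigma_i^a(\alpha_j)=\alpha_j-c^a_{ij}\alpha_i$ for all $j\in I$. Weyl groupoid. $\mathcal W(\mathcal C)$ is the category (a groupoid) with object set $A$ whose morphisms are the compositions of the maps $\sigma_i^a$, each regarded as an element of $\operatorname{Hom}(a,\rho_i(a))$.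 Upper indices are omitted when determined by context; $\mathrm{id}^a\sigma_{i_1}\cdots\sigma_{i_k}$ denotes the composition with target $a$. Roots. $(R^{\mathrm{re}})^a=\{\mathrm{id}^a\sigma_{i_1}\cdots\sigma_{i_k}(\alpha_j)\mid k\ge 0,\ i_1,\dots,i_k,j\in I\}$, $(R^{\mathrm{re}})^a_+=(R^{\mathrm{re}})^a\cap\mathbb N_0^I$, and $\mathcal R^{\mathrm{re}}(\mathcal C)=(\mathcal C,((R^{\mathrm{re}})^a)_{a\in A})$. A family $(R^a)_{a\in A}$ of subsets of $\mathbb Z^I$ is a root system of type $\mathcal C$ if, with $R^a_+=R^a\cap\mathbb N_0^I$ and $m^a_{i,j}=|R^a\cap(\mathbb N_0\alpha_i+\mathbb N_0\alpha_j)|$: (R1) $R^a=R^a_+\cup -R^a_+$; (R2) $R^a\cap\mathbb Z\alpha_i=\{\alpha_i,-\alpha_i\}$; (R3) $\sigma_i^a(R^a)=R^{\rho_i(a)}$; (R4) if $i\ne j$ and $m^a_{i,j}$ is finite then $(\rho_i\rho_j)^{m^a_{i,j}}(a)=a$; for all $a\in A$, $i,j\in I$. It is finite if every $R^a$ is finite. *)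

(* Defs.v *)
From HB Require Import structures.
From mathcomp Require Import all_boot all_order all_algebra.
From mathcomp Require Import all_classical all_reals all_analysis.

Set Implicit Arguments.
Unset Strict Implicit.
Unset Printing Implicit Defensive.

Import Order.TTheory GRing.Theory Num.Theory.
Import numFieldNormedType.Exports.
Local Open Scope classical_set_scope.
Local Open Scope ring_scope.

(* Z^I and R^I are the function types [I -> int] and [I -> R] with their
   pointwise algebraic structure, for an arbitrary finite type [I]. *)

Definition generalized_cartan_matrix (I : finType) (c : I -> I -> int) : Prop :=
  [/\ forall i, c i i = 2,
      forall i j, i != j -> c i j <= 0
    & forall i j, c i j = 0 -> c j i = 0].

Record cartan_scheme (I A : finType) := CartanScheme {
  cs_rho : I -> A -> A;
  cs_mx : A -> I -> I -> int;
  cs_objects : (0 < #|A|)%N;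
  cs_gcm : forall a, generalized_cartan_matrix (cs_mx a);
  cs_rhoK : forall i a, cs_rho i (cs_rho i a) = a;
  cs_mx_rho : forall a i j, cs_mx a i j = cs_mx (cs_rho i a) i j }.

Section CartanScheme.
Variables (I A : finType).
Implicit Types (i j : I) (a : A) (x : I -> int).

Definition simple_root i : I -> int := fun j => (j == i)%:R.

Definition nonneg_vectors : set (I -> int) := [set x | forall i, 0 <= x i].

Variable C : cartan_scheme I A.
Implicit Type Rt : A -> set (I -> int).

(* The Z-linear extension of [alpha_j |-> alpha_j - c^a_ij alpha_i]. *)
Definition reflection i a x : I -> int :=
  \sum_j (simple_root j - simple_root i *~ cs_mx C a i j) *~ x j.

(* [reflection i b] is a morphism from [b] to [rho_i b]; the factor
   [sigma_i] whose target is [a] therefore has source [rho_i a]. *)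
Fixpoint composition_to a (s : seq I) : (I -> int) -> (I -> int) :=
  if s is i :: s' then
    reflection i (cs_rho C i a) \o composition_to (cs_rho C i a) s'
  else id.

Definition real_roots a : set (I -> int) :=
  [set x | exists (s : seq I) (j : I), x = composition_to a s (simple_root j)].

Definition positive_part Rt a : set (I -> int) := Rt a `&` nonneg_vectors.

Definition rank_two_cone i j : set (I -> int) :=
  [set x | exists m n : nat, x = simple_root i *+ m + simple_root j *+ n].

(* In [rs_period], [m] is the cardinality [m^a_ij] whenever that is finite. *)
Record root_system Rt : Prop := RootSystem {
  rs_sign : forall a,
    Rt a = positive_part Rt a `|` [set - x | x in positive_part Rt a];
  rs_reduced : forall a i,
    Rt a `&` [set x | exists z : int, x = simple_root i *~ z]
    = [set simple_root i; - simple_root i];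
  rs_reflection : forall a i, reflection i a @` Rt a = Rt (cs_rho C i a);
  rs_period : forall a i j (m : nat), i != j ->
    (Rt a `&` rank_two_cone i j #= `I_m)%card ->
    iter m (cs_rho C i \o cs_rho C j) a = a }.

Definition finite_root_system Rt : Prop :=
  root_system Rt /\ forall a, finite_set (Rt a).

End CartanScheme.

Section Arrangements.
Variables (R : realType) (I : finType).

Definition is_basis (v : I -> (I -> R)) : Prop :=
  (forall c : I -> R, \sum_i c i *: v i = 0 -> forall i, c i = 0) /\
  (forall x : I -> R, exists c : I -> R, x = \sum_i c i *: v i).

Definition open_simplicial_cone (K : set (I -> R)) : Prop :=
  exists v : I -> (I -> R), is_basis v /\
    K = [set x | exists c : I -> R,
                   (forall i, 0 < c i) /\ x = \sum_i c i *: v i].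

Definition linear_hyperplane (H : set (I -> R)) : Prop :=
  exists f : {linear (I -> R) -> R^o},
    (exists x, f x != 0) /\ H = [set x | f x = 0].

Definition arrangement (Arr : set (set (I -> R))) : Prop :=
  finite_set Arr /\ forall H, Arr H -> linear_hyperplane H.

Definition arrangement_complement (Arr : set (set (I -> R))) : set (I -> R) :=
  ~` \bigcup_(H in Arr) H.

(* [{ptws I -> R}] is [I -> R] with the product topology, which is the usual
   topology of R^I since [I] is finite. *)
Definition simplicial_arrangement (Arr : set (set (I -> R))) : Prop :=
  arrangement Arr /\
  forall x, arrangement_complement Arr x ->
    open_simplicial_cone
      (connected_component (arrangement_complement Arr : set {ptws I -> R}) x).

Definition real_vector (x : I -> int) : I -> R := fun i => (x i)%:~R.

Definition orthogonal_hyperplane (dot : {dot (I -> R) for idfun})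
    (alpha : I -> int) : set (I -> R) :=
  [set l | dot l (real_vector alpha) = 0].

Definition root_arrangement (A : finType) (C : cartan_scheme I A) (a : A)
    (dot : {dot (I -> R) for idfun}) : set (set (I -> R)) :=
  [set orthogonal_hyperplane dot alpha
     | alpha in positive_part (real_roots C) a].

End Arrangements.

(* Main.v *)
(* Let x lie off all the hyperplanes. Pairing roots with x gives an additive
   form without zeros on the roots. While it is negative on some simple root,
   apply the corresponding simple reflection: it carries the remaining positive
   roots onto those of the neighbouring object, hence lowers the number of positive roots where the form is negative.
   This ends with a morphism w to a such that the form is positive on the family
   b_i = w(alpha_i). Every root at a is, up to sign, a nonnegative combination of
   the b_i, so the cone K = {y | (y, b_i) > 0 for all i} avoids every hyperplane;
   it is star-shaped at x, and a connected subset of the complement containing x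
   cannot change the sign of any (-, b_i). Hence K is the component of x, and it
   is the open cone spanned by the basis dual to the b_i. *)
Require Import Defs.
From HB Require Import structures.
From mathcomp Require Import all_boot all_order all_algebra.
From mathcomp Require Import all_classical all_reals all_analysis.

Set Implicit Arguments.
Unset Strict Implicit.
Unset Printing Implicit Defensive.

Import Order.TTheory GRing.Theory Num.Theory.
Import numFieldNormedType.Exports.
Local Open Scope classical_set_scope.
Local Open Scope ring_scope.

(** * Coordinates and additive maps on Z^I *)

Section IntegerVectors.
Variable I : finType.
Implicit Types (x : I -> int) (i j k : I).

Lemma intmul_fctE x (n : int) k : (x *~ n) k = x k *~ n.
Proof. by case: n => n; rewrite /intmul ?fctE ?natmulfctE. Qed.

Lemma simple_rootE x : x = \sum_j simple_root j *~ x j.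
Proof.
apply/funext => k; rewrite fct_sumE (bigD1 k) //= big1 ?addr0 => [|j jk].
  by rewrite intmul_fctE /simple_root eqxx intz.
by rewrite intmul_fctE /simple_root eq_sym (negbTE jk) mul0rz.
Qed.

Lemma raddf_simple_root (V : zmodType) (f : {additive (I -> int) -> V}) x :
  f x = \sum_j f (simple_root j) *~ x j.
Proof.
by rewrite {1}(simple_rootE x) raddf_sum; apply: eq_bigr => j _; rewrite raddfMz.
Qed.

Lemma nonneg_raddf_gt0 (R : realDomainType) (f : {additive (I -> int) -> R}) x :
  (forall i, 0 < f (simple_root i)) -> nonneg_vectors x -> x <> 0 -> 0 < f x.
Proof.
move=> f_gt0 x_ge0 x_neq0.
have [k xk] : exists k, x k != 0.
  apply: contrapT => /forallNP xk0; apply: x_neq0; apply/funext => k.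
  by have /negP := xk0 k; rewrite negbK => /eqP.
rewrite raddf_simple_root (bigD1 k) //= ltr_pwDl //.
  by rewrite pmulrz_lgt0 // lt_def xk x_ge0.
by apply: sumr_ge0 => j _; rewrite mulrz_ge0 ?(ltW (f_gt0 j)) ?x_ge0.
Qed.

End IntegerVectors.

(** * Simple reflections and their compositions *)

Section Reflections.
Variables (I A : finType) (C : cartan_scheme I A).
Implicit Types (a b : A) (i j : I) (x : I -> int).

Lemma reflectionE i a x :
  reflection C i a x = x - simple_root i *~ \sum_j cs_mx C a i j * x j.
Proof.
rewrite {2}(simple_rootE x) /reflection mulrz_sumr -sumrB.
by apply: eq_bigr => j _; rewrite mulrzBl mulrzA.
Qed.

Lemma reflection_is_zmod_morphism i a : zmod_morphism (reflection C i a).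
Proof.
move=> x y; rewrite /reflection -sumrB.
by apply: eq_bigr => j _; rewrite -mulrzBr.
Qed.

HB.instance Definition _ i a := GRing.isZmodMorphism.Build _ _
  (reflection C i a) (@reflection_is_zmod_morphism i a).

Lemma composition_to_is_zmod_morphism a s : zmod_morphism (composition_to C a s).
Proof.
elim: s a => [|i s IHs] a x y //=.
by rewrite IHs raddfB.
Qed.

HB.instance Definition _ a s := GRing.isZmodMorphism.Build _ _
  (composition_to C a s) (@composition_to_is_zmod_morphism a s).

Lemma reflection_simple_root i a :
  reflection C i a (simple_root i) = - simple_root i.
Proof.
have [cii _ _] := cs_gcm C a.
rewrite reflectionE (bigD1 i) //= big1 => [|j ji].
  by rewrite /simple_root eqxx mulr1 addr0 cii mulrzDr mulr1z opprD addNKr.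
by rewrite /simple_root (negbTE ji) mulr0.
Qed.

(** The matrices at [a] and [cs_rho C i a] share row [i], and the second reflection negates
    [simple_root i], so the two corrections cancel. *)
Lemma reflectionK i a : cancel (reflection C i a) (reflection C i (cs_rho C i a)).
Proof.
move=> x; rewrite (reflectionE i a) raddfB raddfMz /= reflection_simple_root.
rewrite reflectionE mulNrz opprK.
under eq_bigr do rewrite cs_mx_rho.
by rewrite subrK.
Qed.

Lemma reflection_eval i a x k : k != i -> reflection C i a x k = x k.
Proof.
move=> ki; rewrite reflectionE !fctE intmul_fctE /simple_root (negbTE ki).
by rewrite mul0rz subr0.
Qed.

(** * Signs of roots and the search for a chamber *)

Section RootSystem.
Variable Rt : A -> set (I -> int).
Hypothesis Rt_root : root_system C Rt.

Lemma root_sign a x :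
  Rt a x -> nonneg_vectors x \/ nonneg_vectors (- x).
Proof.
rewrite (rs_sign Rt_root) => -[[_]|[y [_ y_ge0] <-]]; first by left.
by right; rewrite opprK.
Qed.

Lemma simple_root_in a i : Rt a (simple_root i).
Proof.
suff : (Rt a `&` [set x | exists z : int, x = simple_root i *~ z]) (simple_root i).
  by case.
by rewrite (rs_reduced Rt_root); left.
Qed.

Lemma rootN a x : Rt a x -> Rt a (- x).
Proof.
rewrite (rs_sign Rt_root) => -[xp|[y yp <-]]; first by right; exists x.
by left; rewrite opprK.
Qed.

(** Zero lies on the line of [simple_root i], where (R2) allows only [simple_root i] and its
    negative. *)
Lemma root_neq0 a (i : I) x : Rt a x -> x <> 0.
Proof.
move=> ax x0.
suff : [set simple_root i; - simple_root i] x.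
  rewrite x0 => -[] /(congr1 (fun f => f i)).
    by rewrite /simple_root eqxx.
  by rewrite fctE /simple_root eqxx.
rewrite -(rs_reduced Rt_root a); split=> //.
by exists 0; rewrite x0.
Qed.

Lemma root_reflection a i x : Rt a x -> Rt (cs_rho C i a) (reflection C i a x).
Proof. by move=> ax; rewrite -(rs_reflection Rt_root); exists x. Qed.

(** By (R2), [x] has a nonzero coordinate at some [k != i]. The reflection keeps it, and by (R1)
    this one positive coordinate decides the sign of the image. *)
Lemma positive_reflection a i x : positive_part Rt a x -> x <> simple_root i ->
  positive_part Rt (cs_rho C i a) (reflection C i a x).
Proof.
move=> [ax x_ge0] xi; split; first exact: root_reflection.
have [k ki xk] : exists2 k, k != i & x k != 0.
  apply: contrapT => /forall2NP xk0.
  suff : [set simple_root i; - simple_root i] x.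
    case=> // xE; have := x_ge0 i.
    by rewrite xE fctE /simple_root eqxx.
  rewrite -(rs_reduced Rt_root a); split=> //.
  exists (x i); apply/funext => k; rewrite intmul_fctE /simple_root.
  have [->|ki] := eqVneq k i; first by rewrite intz.
  by have [|/negP] := xk0 k; rewrite ?ki ?negbK // mul0rz => /eqP.
have [//|Nx_ge0] := root_sign (root_reflection i ax).
have := Nx_ge0 k; rewrite fctE reflection_eval // oppr_ge0 => xk_le0.
by case/negP: xk; rewrite eq_le xk_le0 x_ge0.
Qed.

(* Reflecting at a simple root where [f] is negative keeps the other positive
   roots positive, so the list [l] covering those with [f < 0] gets shorter. *)
Lemma chamber_exists (R : realDomainType) a (f : {additive (I -> int) -> R})
    (l : seq (I -> int)) :
  (forall x, Rt a x -> f x != 0) ->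
  (forall x, positive_part Rt a x -> f x < 0 -> x \in l) ->
  exists s, forall i, 0 < f (composition_to C a s (simple_root i)).
Proof.
have [n] := ubnP (size l); elim: n => // n IHn in a f l *.
rewrite ltnS => ln f_neq0 lf.
have [f_gt0|/existsNP[i /negP]] := pselect (forall i, 0 < f (simple_root i)).
  by exists [::].
rewrite -leNgt le_eqVlt (negbTE (f_neq0 _ (simple_root_in a i))) /= => fi_lt0.
have ia : positive_part Rt a (simple_root i).
  by split=> [|k]; [exact: simple_root_in|rewrite /simple_root ler0n].
pose b := cs_rho C i a; have bK : cs_rho C i b = a by rewrite cs_rhoK.
have rK : cancel (reflection C i b) (reflection C i a).
  by have := @reflectionK i b; rewrite bK.
(* The form seen from [b]: a word [s] that works for [g] at [b] yields [i :: s] for [f] at [a]. *)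
pose g : {additive (I -> int) -> R} := f \o reflection C i b.
pose l' := [seq reflection C i a x | x <- l & x != simple_root i].
have [|||s gs] := IHn b g l'.
(* The list shrinks strictly because [f] is negative on [simple_root i], which therefore lies in
   [l]. *)
- rewrite size_map size_filter; apply: leq_trans ln.
  rewrite -(count_predC (pred1 (simple_root i)) l) -[X in (X < _)%N]add0n.
  by rewrite ltn_add2r -has_count has_pred1; exact: lf.
- by move=> x bx; apply: f_neq0; rewrite -bK; exact: root_reflection.
- move=> x bx gx; have xi : x <> simple_root i.
    move=> xi; move: gx; rewrite /g /= xi reflection_simple_root raddfN.
    by rewrite oppr_lt0 ltNge (ltW fi_lt0).
  have := positive_reflection bx xi; rewrite bK => ax.
  apply/mapP; exists (reflection C i b x); last by rewrite rK.
  (* Otherwise [x] would be [- simple_root i], which is not positive. *)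
  rewrite mem_filter lf // andbT /=; apply/eqP => /(congr1 (reflection C i a)).
  rewrite rK reflection_simple_root => xE.
  case: bx => _ /(_ i); rewrite xE fctE /simple_root eqxx.
  by [].
by exists (i :: s) => j; exact: gs.
Qed.

(** Reflections are invertible, so the word can be peeled off [x] letter by letter; [b] is the
    source of the composition. *)
Lemma composition_to_surj a s : exists b, forall x,
  exists2 y, x = composition_to C a s y & (Rt a x -> Rt b y).
Proof.
elim: s a => [|i s IHs] a; first by exists a => x; exists x.
have [b IHb] := IHs (cs_rho C i a); exists b => x.
have [y xy Rxy] := IHb (reflection C i a x).
exists y; first by rewrite /= -xy reflectionK.
by move=> ax; apply: Rxy; exact: root_reflection.
Qed.

End RootSystem.
End Reflections.

(** * Continuity, linear forms and simplicial cones in R^I *)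

Lemma ptws_continuous (I : Type) (T U : topologicalType) (g : T -> (I -> U)) :
  (forall i, continuous (fun t => g t i)) ->
  continuous (g : T -> {ptws I -> U}).
Proof.
move=> g_cont t; apply/cvg_sup => i B [_ [[V oV <-] Vgt] /filterS]; apply.
by apply: g_cont; exact: open_nbhs_nbhs.
Qed.

Section Cones.
Variables (R : realType) (I : finType).
Implicit Types (x y : I -> R) (i j : I).

Definition unit_vector i : I -> R := fun j => (j == i)%:R.

Lemma unit_vectorE x : x = \sum_j x j *: unit_vector j.
Proof.
apply/funext => k; rewrite fct_sumE (bigD1 k) //= big1 ?addr0 => [|j jk].
  by rewrite fctE /unit_vector eqxx [RHS]mulr1.
by rewrite fctE /unit_vector eq_sym (negbTE jk) [LHS]mulr0.
Qed.

Lemma linear_unit_vector (f : {linear (I -> R) -> R^o}) x :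
  f x = \sum_j x j * f (unit_vector j).
Proof.
rewrite {1}(unit_vectorE x) raddf_sum; apply: eq_bigr => j _.
by rewrite /= linearZ.
Qed.

Lemma linear_form_continuous (f : {linear (I -> R) -> R^o}) :
  continuous (f : {ptws I -> R} -> R).
Proof.
have -> : (f : _ -> R) = fun x => \sum_j x j * f (unit_vector j).
  by apply/funext => x; exact: linear_unit_vector.
apply: (@continuous_big R I +%R 0 xpredT (@add_continuous R) {ptws I -> R}).
move=> j _ x; apply: (@cvgMr_tmp R {ptws I -> R} (nbhs x) _ (fun y => y j)).
exact: (@proj_continuous I (fun=> R) j x).
Qed.

Lemma segment_ptws_connected x y :
  connected ([set (1 - t) *: x + t *: y | t in `[0, 1]] : set {ptws I -> R}).
Proof.
apply: (@connected_continuous_connected R {ptws I -> R}).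
  exact: segment_connected.
apply/continuous_subspaceT/(@ptws_continuous I R R) => i t.
apply: (@cvgD R R); apply: (@cvgMr_tmp R); last exact: cvg_id.
by apply: (@cvgB R R); [exact: cvg_cst|exact: cvg_id].
Qed.

Section LinearForms.
Variable f : I -> {linear (I -> R) -> R^o}.
Hypothesis f_inj : forall x, (forall i, f i x = 0) -> x = 0.

(** The matrix [M] of values of the forms on unit vectors has trivial left kernel by [f_inj], hence
    is invertible; the rows of its inverse give the dual vectors. *)
Lemma dual_family : exists v : I -> (I -> R), forall i j, f j (v i) = (i == j)%:R.
Proof.
pose M : 'M[R]_#|I| := \matrix_(i, j) f (enum_val j) (unit_vector (enum_val i)).
pose vec (c : 'rV[R]_#|I|) : I -> R := fun i => c 0 (enum_rank i).
have fvec c (j : 'I_#|I|) : f (enum_val j) (vec c) = (c *m M) 0 j.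
  rewrite linear_unit_vector mxE (reindex_onto enum_rank enum_val) /=; last first.
    by move=> *; rewrite enum_valK.
  under [RHS]eq_bigl do rewrite enum_rankK eqxx.
  by apply: eq_bigr => i _; rewrite mxE enum_rankK.
have Mu : M \in unitmx.
  rewrite -row_free_unit; apply: inj_row_free => c cM0.
  suff c0 : vec c = 0.
    apply/rowP => j; rewrite mxE -(enum_valK j).
    exact: (congr1 (fun g => g (enum_val j)) c0).
  by apply: f_inj => i; rewrite -(enum_rankK i) fvec cM0 mxE.
exists (fun i => vec (row (enum_rank i) (invmx M))) => i j.
rewrite -[j in LHS]enum_rankK fvec -row_mul mulVmx // !mxE.
by rewrite (inj_eq enum_rank_inj).
Qed.

(** The values [f i x] are the coordinates of [x] in the dual family, which is thus a basis. *)
Lemma positivity_cone : open_simplicial_cone [set x | forall i, 0 < f i x].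
Proof.
have [v fv] := dual_family.
have fsum (c : I -> R) k : f k (\sum_i c i *: v i) = c k.
  rewrite raddf_sum (bigD1 k) //= big1 => [|i ik].
    by rewrite addr0 linearZ /= fv eqxx [LHS]mulr1.
  by rewrite linearZ /= fv (negbTE ik) [LHS]mulr0.
have vsum x : x = \sum_i f i x *: v i.
  apply/eqP; rewrite -subr_eq0; apply/eqP/f_inj => k.
  by rewrite raddfB /= fsum subrr.
exists v; split; first split.
- by move=> c c0 i; rewrite -(fsum c) c0 raddf0.
- by move=> x; exists (fun i => f i x).
apply/seteqP; split=> x /= => [fx|[c [c_gt0 ->]] i]; last by rewrite fsum.
by exists (fun i => f i x); split.
Qed.

Lemma positivity_cone_component (S : set (I -> R)) (x : I -> R) :
  (forall y i, S y -> f i y != 0) ->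
  [set y | forall i, 0 < f i y] `<=` S -> (forall i, 0 < f i x) ->
  connected_component (S : set {ptws I -> R}) x = [set y | forall i, 0 < f i y].
Proof.
move=> S_neq0 KS fx; apply/seteqP; split=> [y Sxy i|]; last first.
  move=> y fy; pose B := [set (1 - t) *: x + t *: y | t in `[0, 1]].
  apply: (@connected_component_max {ptws I -> R} S B x).
  - by exists 0; [rewrite /= in_itv /= lexx ler01|rewrite subr0 scale1r scale0r addr0].
  - move=> _ [t + <-]; rewrite /= in_itv /= => /andP[t0 t1]; apply: KS => i.
    rewrite raddfD /= !linearZ /= /GRing.scale /=.
    (* For [t > 0] the second summand is positive; at [t = 0] it vanishes and positivity comes from
       [x]. *)
    have [->|tn0] := eqVneq t 0; first by rewrite subr0 mul1r mul0r addr0.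
    have t_gt0 : 0 < t by rewrite lt_def tn0.
    by apply: ltr_wpDl; rewrite ?mulr_gt0 // mulr_ge0 ?subr_ge0 // ltW.
  - exact: segment_ptws_connected.
  by exists 1; [rewrite /= in_itv /= lexx ler01|rewrite subrr scale1r scale0r add0r].
(* Intermediate values: if [f i y <= 0], then [f i] vanishes somewhere on the component, hence at a
   point of [S]. *)
have : is_interval (f i @` connected_component (S : set {ptws I -> R}) x).
  apply/connected_intervalP/connected_continuous_connected.
    exact: component_connected.
  exact/continuous_subspaceT/linear_form_continuous.
move=> /(_ (f i y) (f i x)) fS; rewrite ltNge; apply/negP => fy.
have [|||z /connected_component_sub Sz fz0] := fS _ _ 0.
- by exists y.
- by exists x => //; apply: connected_component_refl; exact: KS.
- by rewrite fy ltW.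
by have := S_neq0 z i Sz; rewrite fz0 eqxx.
Qed.

End LinearForms.
End Cones.

(** * The scalar product with integer vectors *)

Section Pairing.
Variables (R : realType) (I : finType) (dot : {dot (I -> R) for idfun}).
Implicit Types (x y : I -> R) (alpha : I -> int).

Definition pairing_with y : (I -> R) -> R^o := dot^~ y.

Lemma pairing_with_is_linear y : linear (pairing_with y).
Proof. by move=> c u v; exact: linearPl. Qed.

HB.instance Definition _ y := GRing.isLinear.Build R (I -> R) R^o _
  (pairing_with y) (pairing_with_is_linear y).

Lemma real_vector_is_zmod_morphism : zmod_morphism (@real_vector R I).
Proof. by move=> x y; apply/funext => i; rewrite /real_vector !fctE rmorphB. Qed.

HB.instance Definition _ := GRing.isZmodMorphism.Build _ _
  (@real_vector R I) real_vector_is_zmod_morphism.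

Definition root_pairing x : {additive (I -> int) -> R} := dot x \o @real_vector R I.

(** Unit vectors are the images of simple roots, so [x] is orthogonal to itself, and the scalar
    product is positive definite. *)
Lemma root_pairing_eq0 x : (forall alpha, root_pairing x alpha = 0) -> x = 0.
Proof.
move=> x0; apply/eqP/negPn/negP => /(@neq0_dnorm_gt0 _ _ _ dot).
rewrite {2}(unit_vectorE x) raddf_sum big1 ?ltxx // => j _.
have -> : unit_vector R j = real_vector R (simple_root j).
  by apply/funext => k; rewrite /real_vector /simple_root mulrz_nat.
have xj : dot x (real_vector R (simple_root j)) = 0 := x0 (simple_root j).
rewrite /= linearZr_LR; exact: etrans (congr1 ( *%R (x j)) xj) (mulr0 _).
Qed.

Lemma orthogonal_hyperplane_linear alpha : alpha <> 0 ->
  linear_hyperplane (orthogonal_hyperplane dot alpha).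
Proof.
move=> alpha_neq0; exists (pairing_with (real_vector R alpha)); split=> //.
exists (real_vector R alpha); rewrite gt_eqF // neq0_dnorm_gt0 //.
apply/eqP => r0; apply: alpha_neq0.
apply/funext => i; have /eqP := congr1 (fun x : I -> R => x i) r0.
by rewrite /real_vector intr_eq0 => /eqP.
Qed.

End Pairing.

(** * The root hyperplanes and their chambers *)

Theorem corollary4p7 (R : realType) (I A : finType) (C : cartan_scheme I A)
    (hC : finite_root_system C (real_roots C)) (a : A)
    (dot : {dot (I -> R) for idfun}%R) :
  simplicial_arrangement (root_arrangement C a dot).
Proof.
have [rtC finC] := hC.
split=> [|x Sx].
  split; first exact/finite_image/finite_setIl.
  move=> _ [alpha [ra _] <-]; apply: orthogonal_hyperplane_linear.
  by have [_ [i _]] := ra; exact: (root_neq0 rtC i ra).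
have S_neq0 y alpha : arrangement_complement (root_arrangement C a dot) y ->
    real_roots C a alpha -> root_pairing dot y alpha != 0.
  move=> Sy ra; apply/eqP => y0; apply: Sy.
  have [alpha_ge0|alpha_le0] := root_sign rtC ra.
    by exists (orthogonal_hyperplane dot alpha) => //; exists alpha.
  (* Hyperplanes are indexed by positive roots; a negative root shares its hyperplane with its
     opposite. *)
  exists (orthogonal_hyperplane dot (- alpha)).
    by exists (- alpha) => //; split=> //; exact: (rootN rtC).
  have : root_pairing dot y (- alpha) = 0 by rewrite raddfN y0 oppr0.
  exact.
have [l lE] := (finite_seqP _).1 (finC a).
have [s s_gt0] : exists s, forall i,
    0 < root_pairing dot x (composition_to C a s (simple_root i)).
  apply: (chamber_exists rtC (l := l)) => [alpha|alpha [ra _] _].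
    exact: S_neq0.
  by have : [set` l] alpha by rewrite -lE.
have [b wP] := composition_to_surj rtC a s.
pose w : {additive (I -> int) -> (I -> int)} := composition_to C a s.
pose f i : {linear (I -> R) -> R^o} :=
  pairing_with dot (real_vector R (w (simple_root i))).
rewrite (@positivity_cone_component _ _ f).
(* Every integer vector is some [w z], so a vector killed by all the forms pairs to zero with all of
   Z^I. *)
- apply: positivity_cone => y fy; apply: (@root_pairing_eq0 _ _ dot) => alpha.
  have [z -> _] := wP alpha.
  apply: etrans (raddf_simple_root (root_pairing dot y \o w) z) _.
  apply: big1 => i _.
  exact: etrans (congr1 (fun c : R => c *~ z i) (fy i)) (mul0rz _ _).
- by move=> y i /S_neq0; apply; exists s, i.
(* Write [alpha] as [w z] with [z] a root at [b]: by (R1), [z] or [- z] is a nonnegative combination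
   of simple roots, so the pairing of [y] with [alpha] is nonzero. *)
- move=> y fy [_ [alpha [ra _] <-]]; rewrite /orthogonal_hyperplane /=.
  have [z zE /(_ ra) rz] := wP alpha.
  have [_ [i _]] := ra; have z_neq0 := root_neq0 rtC i rz.
  have pos := nonneg_raddf_gt0 (f := root_pairing dot y \o w) fy.
  rewrite zE -/(root_pairing dot y (w z)) => /eqP.
  have [z_ge0|z_le0] := root_sign rtC rz; first by rewrite gt_eqF // pos.
  have Nz_neq0 : - z <> 0 by move=> /eqP; rewrite oppr_eq0 => /eqP.
  by have := pos _ z_le0 Nz_neq0; rewrite raddfN oppr_gt0 => /lt_eqF ->.
- exact: s_gt0.
Qed.
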